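(* Let $m\ge 2$, $D\ge 0$, $n\ge 1$, $\beta\in(0,1)$, let $x=x_{-D+1}^n$ be a real-valued time series, and let $Q:\mathbb R\to A=\{0,\dots,m-1\}$ be a quantiser. Consider the Bayesian Context Trees State Space Model with arbitrary parametric models at the contexts, the tree prior $\pi(T)=\pi_D(T;\beta)$ on $\mathcal T(D)$, and independent parameter priors $\pi(\theta\mid T)=\prod_{s\in T}\pi(\theta_s)$. Let $T_{\rm MAX}$ be the tree built from the discrete contexts of $x$ and, for the nodes $s$ of $T_{\rm MAX}$, define recursively from the leaves to the root $$P_{w,s}=\begin{cases}P_e(s,x), & \text{if } s \text{ is a leaf of } T_{\rm MAX},\\ \beta P_e(s,x)+(1-\beta)\prod_{j=0}^{m-1}P_{w,sj}, & \text{otherwise,}\end{cases}$$ where $sj$ is the concatenation of the context $s$ and the symbol $j$. Then the value of $P_{w,s}$ at the root is exactly the normalising constant (evidence) $$p(x)=\sum_{T\in\mathcal T(D)}\pi(T)\int_\theta p(x\mid T,\theta)\,\pi(\theta\mid T)\,d\theta .$$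
   Context: Notation: $x_i^j=(x_i,x_{i+1},\dots,x_j)$. The alphabet is $A=\{0,\dots,m-1\}$. The quantiser $Q:\mathbb R\to A$ is given by thresholds $c_1<\dots<c_{m-1}$: $Q(x)=0$ for $x<c_1$, $Q(x)=i$ for $x$ between $c_i$ and $c_{i+1}$ ($1\le i\le m-2$), and $Q(x)=m-1$ for $x>c_{m-1}$, with any fixed convention at the thresholds themselves. Put $y_i=Q(x_i)$. Trees: nodes of $m$-ary trees are identified with finite strings over $A$; the root is the empty string, the children of $s$ are $sj$, $j\in A$, and the depth of a node is its length. A tree is proper if every node that is not a leaf has exactly $m$ children. $\mathcal T(D)$ is the set of all proper $m$-ary trees of depth at most $D$ (including the tree consisting only of the root). A tree $T$ is identified with its set of leaves; $|T|$ is the number of leaves and $L_D(T)$ is the number of leaves at depth $D$. Tree prior: $\pi(T)=\pi_D(T;\beta)=\alpha^{|T|-1}\beta^{|T|-L_D(T)}$, where $\alpha=(1-\beta)^{1/(m-1)}$. Contexts: for $1\le i\le n$ let $t_i=(y_{i-1},y_{i-2},\dots,y_{i-D})$ (most recent symbol first). For a string $s$ of length at most $D$, $B_s$ is the set of $i\in\{1,\dots,n\}$ such that $s$ is an initial segment of $t_i$ (the first $|s|$ symbols of $t_i$ are $s$). For $T\in\mathcal T(D)$, the context (state) of $x_i$ is the unique leaf $s$ of $T$ with $i\in B_s$. Model: with each string $s$ of length at most $D$ are associated a parametric model with parameter $\theta_s$, i.e. conditional densities $p(x_i\mid T,\theta_s,x_{-D+1}^{i-1})$ for $x_i$ when its context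 is $s$ (depending on $T$ only through $s$), and a prior probability density $\pi(\theta_s)$. For $T\in\mathcal T(D)$ and $\theta=\{\theta_s: s\in T\}$ the likelihood, conditional on the initial samples $x_{-D+1}^0$, is $$p(x\mid T,\theta)=\prod_{s\in T}\ \prod_{i\in B_s}p(x_i\mid T,\theta_s,x_{-D+1}^{i-1}).$$ Estimated probabilities: for each string $s$ of length at most $D$, $$P_e(s,x)=\int\prod_{i\in B_s}p(x_i\mid T,\theta_s,x_{-D+1}^{i-1})\,\pi(\theta_s)\,d\theta_s,$$ assumed well defined and finite (when $B_s=\emptyset$ the product is empty and $P_e(s,x)=1$). $T_{\rm MAX}$ is the smallest proper $m$-ary tree that has all the strings $t_i$, $1\le i\le n$, as leaves; thus it may also have leaves $s$ with $B_s=\emptyset$. *)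

(* Defs.v *)
From HB Require Import structures.
From mathcomp Require Import all_boot all_order all_algebra.
From mathcomp Require Import all_classical all_reals all_analysis.

Set Implicit Arguments.
Unset Strict Implicit.
Unset Printing Implicit Defensive.

Import Order.TTheory GRing.Theory Num.Theory.
Local Open Scope ring_scope.

(* [c k] is the threshold c_k for 1 <= k <= m - 1 (other indices are unused);
   [Q] takes the value k strictly between c_k and c_(k+1), with c_0 = -oo and
   c_m = +oo, and is unconstrained at the thresholds. *)
Definition is_quantiser (R : realType) (m : nat) (c : nat -> R)
    (Q : R -> 'I_m) : Prop :=
  (forall k l : nat, (0 < k)%N -> (k < l)%N -> (l < m)%N -> c k < c l) /\
  (forall (k : 'I_m) (z : R),
     ((0 < k)%N -> c k < z) -> ((k.+1 < m)%N -> z < c k.+1) -> Q z = k).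

Section trees.
Variables m D : nat.

(* A tree of depth at most D is given by its set of nodes; a node is a string
   of length at most D over 'I_m. *)
Definition tree : predArgType := {set D.-bseq 'I_m}.

(* Membership of a plain string, so that [rcons s j] needs no length bound. *)
Definition is_node (T : tree) (s : seq 'I_m) : bool :=
  [exists u : D.-bseq 'I_m, (u \in T) && (bseqval u == s)].

Definition leaves (T : tree) : {set D.-bseq 'I_m} :=
  [set s in T | [forall j : 'I_m, ~~ is_node T (rcons s j)]].

Definition proper_tree (T : tree) : bool :=
  [&& is_node T [::],
      [forall s : D.-bseq 'I_m, forall j : 'I_m,
         is_node T (rcons s j) ==> (s \in T)]
    & [forall s : D.-bseq 'I_m, (s \in T) && (s \notin leaves T) ==>
         [forall j : 'I_m, is_node T (rcons s j)]]].

Definition deep_leaves (T : tree) : {set D.-bseq 'I_m} :=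
  [set s in leaves T | size s == D].

Definition tree_prior (R : realType) (beta : R) (T : tree) : R :=
  let alpha := (1 - beta) `^ (m.-1%:R^-1) in
  alpha ^+ (#|leaves T| - 1) * beta ^+ (#|leaves T| - #|deep_leaves T|).

End trees.

Section contexts.
Variables (R : realType) (m D n : nat) (Q : R -> 'I_m).
Variable x : (D + n).-tuple R.

(* The tuple x lists x_(-D+1), ..., x_0, x_1, ..., x_n.  An index i : 'I_n
   stands for the time i + 1, whose sample is at position D + i of x. *)
Definition obs (i : 'I_n) : R := nth 0 x (D + i).

Definition past (i : 'I_n) : seq R := take (D + i) x.

Definition context (i : 'I_n) : D.-tuple 'I_m :=
  [tuple Q (nth 0 x (D + i - j.+1)) | j < D].

Definition times_at (s : D.-bseq 'I_m) : {set 'I_n} :=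
  [set i : 'I_n | prefix s (context i)].

Definition has_contexts (T : tree m D) : Prop :=
  forall i : 'I_n, (context i : D.-bseq 'I_m) \in leaves T.

Definition is_Tmax (T : tree m D) : Prop :=
  [/\ proper_tree T, has_contexts T
    & forall T' : tree m D, proper_tree T' -> has_contexts T' -> T \subset T'].

End contexts.

Lemma is_nodeP (m D : nat) (T : tree m D) (s : seq 'I_m) :
  reflect (exists2 u : D.-bseq 'I_m, u \in T & bseqval u = s) (is_node T s).
Proof.
by apply: (iffP existsP) => [[u /andP[uT /eqP us]]|[u uT us]]; exists u;
  rewrite // uT us eqxx.
Qed.

Lemma is_node_bseq (m D : nat) (T : tree m D) (s : D.-bseq 'I_m) :
  is_node T s = (s \in T).
Proof.
by apply/is_nodeP/idP => [[u uT /val_inj <-]//|sT]; exists s.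
Qed.

Lemma is_node_size (m D : nat) (T : tree m D) (s : seq 'I_m) :
  is_node T s -> (size s <= D)%N.
Proof. by case/is_nodeP => u _ <-; exact: size_bseq. Qed.

Lemma proper_treeP (m D : nat) (T : tree m D) :
  reflect [/\ is_node T [::],
              (forall (s : D.-bseq 'I_m) j, is_node T (rcons s j) -> s \in T)
            & (forall s : D.-bseq 'I_m, s \in T -> s \notin leaves T ->
                 forall j, is_node T (rcons s j))]
          (proper_tree T).
Proof.
apply: (iffP and3P) => -[T0 Tp Tc]; split=> //.
- move=> s j sj; move: Tp => /forallP Tp; have /forallP Tps := Tp s.
  exact: (implyP (Tps j)).
- move=> s sT sl; move: Tc => /forallP Tc; apply/forallP.
  by apply: (implyP (Tc s)); rewrite sT.
- apply/forallP => s; apply/forallP => j; apply/implyP; exact: Tp.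
- apply/forallP => s; apply/implyP => /andP[sT sl]; apply/forallP; exact: Tc.
Qed.

Lemma Tmax_exists (R : realType) (m D n : nat) (Q : R -> 'I_m)
    (x : (D + n).-tuple R) : exists T : tree m D, is_Tmax Q x T.
Proof.
pose ok (T : tree m D) := proper_tree T &&
  [forall i : 'I_n, (context Q x i : D.-bseq 'I_m) \in leaves T].
have szc i : size (context Q x i) = D by rewrite size_tuple.
pose T0 : tree m D := [set s | [forall T : tree m D, ok T ==> (s \in T)]].
have T0P s : is_node T0 s <-> (size s <= D)%N /\ forall T, ok T -> is_node T s.
  split=> [/is_nodeP[u + <-]|[sD sT]].
    rewrite inE => /forallP uT; split; first exact: size_bseq.
    by move=> T okT; rewrite is_node_bseq; exact: (implyP (uT T)).
  apply/is_nodeP; exists (Bseq sD) => //; rewrite inE; apply/forallP => T.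
  by apply/implyP => /sT; rewrite -is_node_bseq.
have nodeT s : is_node [set: D.-bseq 'I_m] s = (size s <= D)%N.
  apply/idP/idP => [/is_node_size//|sD]; apply/is_nodeP.
  by exists (Bseq sD); rewrite ?inE.
have okfull : ok [set: D.-bseq 'I_m].
  apply/andP; split; last first.
    apply/forallP => i; rewrite !inE /=; apply/forallP => j.
    by rewrite nodeT size_rcons szc ltnn.
  apply/proper_treeP; split; first by rewrite nodeT.
    by move=> s j _; rewrite inE.
  move=> s _; rewrite !inE /= negb_forall => /existsP[j].
  by rewrite negbK nodeT size_rcons => sD k; rewrite nodeT size_rcons.
have T0proper : proper_tree T0.
  apply/proper_treeP; split.
  - by apply/T0P; split=> // T /andP[/proper_treeP[]].
  - move=> s j /T0P[_ sT]; rewrite -is_node_bseq; apply/T0P.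
    split=> [|T okT]; first exact: size_bseq.
    have /andP[/proper_treeP[_ c1 _] _] := okT.
    by rewrite is_node_bseq; apply: c1; exact: sT.
  - move=> s sT0; rewrite inE sT0 /= negb_forall => /existsP[j].
    rewrite negbK => /T0P[sD sT] k; apply/T0P; split=> [|T okT].
      by move: sD; rewrite !size_rcons.
    have /andP[/proper_treeP[_ c1 c2] _] := okT.
    have sjT := sT T okT; apply: c2; first exact: c1 sjT.
    by rewrite inE (c1 _ _ sjT) /= negb_forall; apply/existsP; exists j; rewrite negbK.
exists T0; split=> //.
- move=> i; rewrite inE; apply/andP; split; last first.
    apply/forallP => j; apply/negP => /is_node_size.
    by rewrite size_rcons szc ltnn.
  rewrite inE; apply/forallP => T; apply/implyP => /andP[_ /forallP/(_ i)].
  by rewrite inE => /andP[].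
- move=> T pT cT; apply/fintype.subsetP => s; rewrite inE => /forallP/(_ T)/implyP; apply.
  by rewrite /ok pT; apply/forallP.
Qed.

Record par_space (R : realType) := ParSpace {
  par_disp : measure_display;
  par_type : measurableType par_disp;
  par_meas : {sigma_finite_measure set par_type -> \bar R} }.

(* The product measure of the library, repackaged: its canonical structures only
   see sigma-finiteness when both factors are subprobabilities. *)
Definition sigma_prod d1 d2 (T1 : measurableType d1) (T2 : measurableType d2)
    (R : realType) (m1 : {sigma_finite_measure set T1 -> \bar R})
    (m2 : {sigma_finite_measure set T2 -> \bar R}) : set (T1 * T2) -> \bar R :=
  (m1 \x m2)%E.

Section sigma_prod.
Local Open Scope classical_set_scope.
Context d1 d2 (T1 : measurableType d1) (T2 : measurableType d2) (R : realType).
Variables (m1 : {sigma_finite_measure set T1 -> \bar R})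
          (m2 : {sigma_finite_measure set T2 -> \bar R}).

HB.instance Definition _ := Measure.copy (sigma_prod m1 m2)
  [the {measure set (T1 * T2)%type -> \bar R} of (m1 \x m2)%E].

Lemma sigma_prod_sigma_finite : sigma_finite setT (sigma_prod m1 m2).
Proof.
have /sigma_finiteP[F [TF ndF Foo]] := sigma_finiteT m1.
have /sigma_finiteP[G [TG ndG Goo]] := sigma_finiteT m2.
exists (fun n => F n `*` G n).
  rewrite -setXTT TF TG predeqE => -[x y]; split.
    move=> [/= [n _ Fnx] [k _ Gky]]; exists (maxn n k) => //; split.
    - by move: x Fnx; exact/subsetPset/ndF/leq_maxl.
    - by move: y Gky; exact/subsetPset/ndG/leq_maxr.
  by move=> [n _ []/= ? ?]; split; exists n.
move=> k; have [? ?] := Foo k; have [? ?] := Goo k.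
split; first exact: measurableX.
by rewrite /sigma_prod product_measure1E// lte_mul_pinfty// ge0_fin_numE.
Qed.

HB.instance Definition _ := Measure_isSigmaFinite.Build _ _ _ (sigma_prod m1 m2)
  sigma_prod_sigma_finite.

End sigma_prod.

Section products.
Variables (R : realType) (I : Type) (E : I -> par_space R).

Definition unit_space : par_space R :=
  @ParSpace R _ unit (@dirac _ unit tt R).

Definition pair_space (E1 E2 : par_space R) : par_space R :=
  ParSpace [the {sigma_finite_measure set (par_type E1 * par_type E2)%type
                  -> \bar R} of sigma_prod (par_meas E1) (par_meas E2)].

Fixpoint prod_space (l : seq I) : par_space R :=
  if l is s :: l' then pair_space (E s) (prod_space l') else unit_space.

(* The point (theta_s)_(s in l) as the list of its labelled coordinates. *)
Fixpoint coords (l : seq I) :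
    par_type (prod_space l) -> seq {s : I & par_type (E s)} :=
  match l return par_type (prod_space l) -> seq {s : I & par_type (E s)} with
  | [::] => fun _ => [::]
  | s :: l' => fun theta =>
      Tagged (fun s => par_type (E s)) theta.1 :: coords theta.2
  end.

End products.

(* [nu] is the reference measure on the state space with respect to which the
   conditional densities are taken.  [dens theta h z] is the density at z of
   the next sample given the whole past h = (x_(-D+1), ..., x_(i-1)), and
   [pdens] is the prior density of theta with respect to [par_meas]. *)
Record param_model (R : realType)
    (nu : {measure set (measurableTypeR R) -> \bar R}) := ParamModel {
  space : par_space R;
  dens : par_type space -> seq R -> R -> R;
  pdens : par_type space -> R;
  dens_ge0 : forall theta h z, 0 <= dens theta h z;
  dens_measurable_par : forall h z,
    measurable_fun setT (fun theta => dens theta h z);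
  dens_measurable_obs : forall theta h,
    measurable_fun setT (fun z : measurableTypeR R => dens theta h z);
  dens_int1 : forall theta h, (\int[nu]_z (dens theta h z)%:E = 1)%E;
  pdens_ge0 : forall theta, 0 <= pdens theta;
  pdens_measurable : measurable_fun setT pdens;
  pdens_int1 : (\int[par_meas space]_theta (pdens theta)%:E = 1)%E }.

Section evidence.
Variables (R : realType) (m D n : nat) (Q : R -> 'I_m).
Variable x : (D + n).-tuple R.
Variable nu : {measure set (measurableTypeR R) -> \bar R}.
Variable M : D.-bseq 'I_m -> param_model nu.

(* The product of p(x_i | T, theta_s, past) over i in B_s. *)
Definition leaf_lik (s : D.-bseq 'I_m) (theta : par_type (space (M s))) : R :=
  \prod_(i in times_at Q x s) dens theta (past x i) (obs x i).

Definition Pe_ext (s : D.-bseq 'I_m) : \bar R :=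
  (\int[par_meas (space (M s))]_theta (leaf_lik theta * pdens theta)%:E)%E.

Definition Pe (s : D.-bseq 'I_m) : R := fine (Pe_ext s).

Definition tree_space (T : tree m D) : par_space R :=
  prod_space (fun s => space (M s)) (enum (leaves T)).

Definition likelihood (T : tree m D) (theta : par_type (tree_space T)) : R :=
  \prod_(a <- coords theta) leaf_lik (tagged a).

Definition par_prior (T : tree m D) (theta : par_type (tree_space T)) : R :=
  \prod_(a <- coords theta) pdens (tagged a).

Definition evidence (beta : R) : \bar R :=
  (\sum_(T : tree m D | proper_tree T)
     (tree_prior beta T)%:E *
     \int[par_meas (tree_space T)]_theta
        (likelihood theta * par_prior theta)%:E)%E.

(* The recursion for the weighted probabilities on the nodes of the tree T;
   the values of Pw at strings that are not nodes of T are irrelevant. *)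
Definition is_weighted (beta : R) (T : tree m D) (Pw : seq 'I_m -> R) : Prop :=
  (forall s : D.-bseq 'I_m, s \in leaves T -> Pw s = Pe s) /\
  (forall s : D.-bseq 'I_m, s \in T -> s \notin leaves T ->
     Pw s = beta * Pe s + (1 - beta) * \prod_(j < m) Pw (rcons s j)).

End evidence.

Lemma weighted_exists (R : realType) (m D n : nat) (Q : R -> 'I_m)
    (x : (D + n).-tuple R) (nu : {measure set (measurableTypeR R) -> \bar R})
    (M : D.-bseq 'I_m -> param_model nu) (beta : R) (T : tree m D) :
  exists Pw : seq 'I_m -> R, is_weighted Q x M beta T Pw.
Proof.
pose pe (s : seq 'I_m) : R := Pe Q x M (insub_bseq D s).
have peE (s : D.-bseq 'I_m) : pe s = Pe Q x M s.
  by rewrite /pe /insub_bseq /insubd valK.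
pose w := fix w k (s : seq 'I_m) : R :=
  if k is k'.+1 then
    if [forall j : 'I_m, ~~ is_node T (rcons s j)] then pe s
    else beta * pe s + (1 - beta) * \prod_(j < m) w k' (rcons s j)
  else pe s.
exists (fun s => w (D - size s)%N s); split=> s.
  by rewrite inE => /andP[_ sl]; rewrite /=; case: (D - _)%N => [|k] /=; rewrite ?sl peE.
move=> sT; rewrite inE sT /= => sl.
have sD : (size s < D)%N.
  move: sl; rewrite negb_forall => /existsP[j]; rewrite negbK => /is_node_size.
  by rewrite size_rcons.
rewrite -(subnSK sD) /= (negbTE sl) peE; congr (_ + _ * _).
by apply: eq_bigr => j _; rewrite size_rcons.
Qed.

(* Main.v *)
(* By Tonelli the integral attached to a tree T factorises over its leaves, so
   that the evidence is the sum over T of pi(T) times the product of the P_e(s),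
   s in T.  After multiplication by alpha the prior factorises as well: alpha
   pi(T) is the product over the leaves of alpha beta^[depth < D].  A sum over
   proper trees of a product over leaves satisfies a recursion on the depth,
   obtained by splitting a tree at its root, and since alpha^m = alpha (1 - beta)
   this is the recursion for alpha P_w.  It agrees with the one that stops at the
   leaves of T_MAX because a leaf of depth less than D has no observations, in
   which case both sides equal alpha. *)

Require Import Defs.
From mathcomp Require Import all_boot all_order all_algebra.
From mathcomp Require Import all_classical all_reals all_analysis.
From mathcomp Require Import measurable_realfun.

Set Implicit Arguments.
Unset Strict Implicit.
Unset Printing Implicit Defensive.

Import Order.TTheory GRing.Theory Num.Theory.
Local Open Scope ring_scope.

(** * Proper trees described by plain strings *)

Section trees.
Variables (m k : nat) (T : tree m k).
Implicit Types s r : seq 'I_m.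

Lemma in_leaves (u : k.-bseq 'I_m) :
  (u \in leaves T) =
    is_node T u && [forall j : 'I_m, ~~ is_node T (rcons u j)].
Proof. by rewrite inE is_node_bseq. Qed.

(** A node is not a leaf exactly when it has some child, so properness becomes closure under parents
    and siblings. Plain strings carry no length bound and can be shifted freely. *)
Lemma proper_tree_nodeP :
  reflect [/\ is_node T [::],
              (forall s j, is_node T (rcons s j) -> is_node T s)
            & (forall s j i, is_node T (rcons s j) -> is_node T (rcons s i))]
          (proper_tree T).
Proof.
apply: (iffP (proper_treeP T)) => -[T0 Tp Tc].
  have par s j : is_node T (rcons s j) -> is_node T s.
    move=> sj; have sk : (size s <= k)%N.
      by have := is_node_size sj; rewrite size_rcons => /ltnW.
    by have := Tp (Bseq sk) j sj; rewrite -is_node_bseq.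
  split=> // s j i sj; have := par _ _ sj; case/is_nodeP=> u uT us.
  rewrite -us; apply: Tc => //; rewrite in_leaves is_node_bseq uT /=.
  by rewrite negb_forall; apply/existsP; exists j; rewrite negbK us.
split=> // [s j /Tp|s sT]; first by rewrite is_node_bseq.
rewrite in_leaves is_node_bseq sT /= negb_forall => /existsP[j].
by rewrite negbK => sj i; apply: Tc sj.
Qed.

Lemma is_node_prefix s r : proper_tree T -> is_node T (s ++ r) -> is_node T s.
Proof.
move=> /proper_tree_nodeP[_ Tp _]; elim/last_ind: r => [|r j IHr].
  by rewrite cats0.
by rewrite -rcons_cat => /Tp.
Qed.

Lemma is_node_cons_head j r i :
  proper_tree T -> is_node T (j :: r) -> is_node T [:: i].
Proof.
move=> Tpr; rewrite -cat1s => /(is_node_prefix Tpr).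
by have /proper_tree_nodeP[_ _ Tc] := Tpr; exact: (Tc [::]).
Qed.

End trees.

Lemma tree_ext (m k : nat) (T T' : tree m k) : is_node T =1 is_node T' -> T = T'.
Proof. by move=> TT'; apply/setP => u; rewrite -!is_node_bseq. Qed.

(** * Decomposition of a tree at its root, and sums over trees *)

Definition root_tree (m k : nat) : tree m k := [set [bseq]].

Lemma is_node_root_tree (m k : nat) s : is_node (root_tree m k) s = (s == [::]).
Proof.
apply/is_nodeP/eqP => [[u]|->]; first by rewrite inE => /eqP -> <-.
by exists [bseq]; rewrite ?inE.
Qed.

Lemma proper_root_tree (m k : nat) : proper_tree (root_tree m k).
Proof.
by apply/proper_tree_nodeP; split=> [|[|? s] j|[|? s] j]; rewrite ?is_node_root_tree.
Qed.

Lemma leaves_root_tree (m k : nat) : leaves (root_tree m k) = [set [bseq]].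
Proof.
apply/setP => u; rewrite in_leaves is_node_root_tree inE -val_eqE /=.
by case: eqP => //= ->; apply/forallP => j; rewrite is_node_root_tree.
Qed.

(** Any nonempty node [j :: r] forces the child [[:: j]] of the root and hence its sibling [[:: i]],
    so testing one fixed child detects the trivial tree. *)
Lemma proper_tree_leaf_root (m k : nat) (T : tree m k) (i : 'I_m) :
  proper_tree T && ~~ is_node T [:: i] = (T == root_tree m k).
Proof.
apply/idP/eqP => [/andP[Tpr Ti]|->]; last first.
  by rewrite proper_root_tree is_node_root_tree.
apply: tree_ext => -[|j r]; rewrite is_node_root_tree.
  by have /proper_tree_nodeP[] := Tpr.
by apply/negbTE; apply: contra Ti; exact: is_node_cons_head.
Qed.

Section graft.
Variables (m k : nat).
Implicit Types f : {ffun 'I_m -> tree m k}.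

Definition graft f : tree m k.+1 :=
  [set u | if bseqval u is j :: r then is_node (f j) r else true].

Definition branches (T : tree m k.+1) : {ffun 'I_m -> tree m k} :=
  [ffun j => [set r : k.-bseq 'I_m | is_node T (j :: r)]].

Lemma is_node_graft f s :
  is_node (graft f) s = if s is j :: r then is_node (f j) r else true.
Proof.
apply/is_nodeP/idP => [[u + <-]|sf]; first by rewrite inE.
have sk : (size s <= k.+1)%N by case: s sf => //= j r /is_node_size.
by exists (Bseq sk); rewrite ?inE.
Qed.

Lemma is_node_branches T j r : is_node (branches T j) r = is_node T (j :: r).
Proof.
rewrite ffunE; apply/is_nodeP/idP => [[u + <-]|jr]; first by rewrite inE.
by exists (Bseq (is_node_size jr : (size r <= k)%N)); rewrite ?inE.
Qed.

Lemma graftK : cancel graft branches.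
Proof.
move=> f; apply/ffunP => j; apply: tree_ext => r.
by rewrite is_node_branches is_node_graft.
Qed.

Lemma branchesK T : proper_tree T -> graft (branches T) = T.
Proof.
move=> /proper_tree_nodeP[T0 _ _]; apply: tree_ext => -[|j r].
  by rewrite is_node_graft T0.
by rewrite is_node_graft is_node_branches.
Qed.

Lemma proper_graft f : (forall j, proper_tree (f j)) -> proper_tree (graft f).
Proof.
move=> fpr; apply/proper_tree_nodeP; split=> [|[|i s] j|[|i s] j l];
  rewrite !is_node_graft //=.
- by have /proper_tree_nodeP[_ + _] := fpr i; apply.
- by have /proper_tree_nodeP[] := fpr l.
- by have /proper_tree_nodeP[_ _] := fpr i; apply.
Qed.

Lemma proper_branches T i j :
  proper_tree T -> is_node T [:: i] -> proper_tree (branches T j).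
Proof.
move=> Tpr Ti; have /proper_tree_nodeP[T0 Tp Tc] := Tpr.
apply/proper_tree_nodeP; split=> [|s l|s l l']; rewrite !is_node_branches.
- exact: is_node_cons_head Ti.
- exact: (Tp (j :: s)).
- exact: (Tc (j :: s)).
Qed.

(** Prefixing by the branch index is injective and maps the leaves of the branches onto those of the
    graft. The hypothesis gives the root a child, so that the root is not a leaf itself. *)
Lemma big_leaves_graft (A : Type) (idx : A) (op : Monoid.com_law idx)
    (i : 'I_m) f (h : seq 'I_m -> A) :
  is_node (f i) [::] ->
  \big[op/idx]_(u in leaves (graft f)) h u =
  \big[op/idx]_j \big[op/idx]_(r in leaves (f j)) h (j :: r).
Proof.
move=> fi; rewrite pair_big_dep /=.
pose cons_pair (p : 'I_m * k.-bseq 'I_m) : k.+1.-bseq 'I_m := [bseq of p.1 :: p.2].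
have cons_inj : injective cons_pair.
  by move=> [j r] [j' r'] /(congr1 val) /= [-> /val_inj ->].
transitivity (\big[op/idx]_(u in cons_pair @:
    [set p : 'I_m * k.-bseq 'I_m | p.2 \in leaves (f p.1)]) h u); last first.
  rewrite big_imset /=; last by move=> p q _ _; exact: cons_inj.
  by apply: eq_bigl => p; rewrite inE.
apply: eq_bigl => u; rewrite in_leaves is_node_graft.
apply/idP/imsetP => [|[[j r]]].
  case: u => -[|j r] /= ur.
    by move=> /forallP/(_ i); rewrite is_node_graft fi.
  move=> /andP[fjr /forallP leaf]; exists (j, Bseq (ur : (size r <= k)%N)).
    rewrite inE /= in_leaves fjr /=; apply/forallP => l.
    by have := leaf l; rewrite is_node_graft.
  exact: val_inj.
rewrite inE /= in_leaves => /andP[fjr /forallP leaf] ->.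
by rewrite /= fjr; apply/forallP => l; rewrite is_node_graft; exact: leaf.
Qed.

End graft.

(* The two summands correspond to the tree reduced to its root and to the trees
   whose root carries [m] subtrees of depth at most [k']. *)
Fixpoint leaf_sum (R : comPzSemiRingType) (m k : nat) (h : seq 'I_m -> R) : R :=
  if k is k'.+1 then h [::] + \prod_j leaf_sum k' (fun r => h (j :: r))
  else h [::].

Lemma sum_proper_tree (R : comPzSemiRingType) (m k : nat) (h : seq 'I_m -> R) :
  (0 < m)%N ->
  \sum_(T : tree m k | proper_tree T) \prod_(u in leaves T) h u = leaf_sum k h.
Proof.
move=> m0; pose i := Ordinal m0.
elim: k h => [|k IHk] h; rewrite (bigID (fun T : tree m _ => is_node T [:: i])) /=
  addrC (eq_bigl _ _ (fun T => proper_tree_leaf_root T i))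
  big_pred1_eq leaves_root_tree big_set1 /=.
  (* With depth bound 0 there is no node of length 1, so only the trivial tree contributes. *)
  rewrite big1 ?addr0// => T /andP[_ /is_node_size].
  by [].
congr (_ + _); under [RHS]eq_bigr do rewrite -IHk.
(* Distributivity turns the product of sums into a sum over families of proper trees; [graft]
   matches these with the trees whose root has children. *)
rewrite (bigA_distr_big_dep _ (fun j T => \prod_(u in leaves T) h (j :: u))).
pose fam := [set f | f \in family (fun _ : 'I_m => @proper_tree m k)].
have fam_proper f : f \in fam -> forall j, proper_tree (f j).
  by rewrite inE => /familyP ff j; exact: ff.
transitivity (\sum_(T in [set graft f | f in fam]) \prod_(u in leaves T) h u).
  apply: eq_bigl => T; apply/andP/imsetP => [[Tpr Ti]|[f /fam_proper fpr ->]].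
    exists (branches T); rewrite ?branchesK// inE.
    by apply/familyP => j; exact: proper_branches Ti.
  split; first exact: proper_graft.
  by rewrite is_node_graft; have /proper_tree_nodeP[] := fpr i.
rewrite big_imset /=; last by move=> f g _ _; exact: (can_inj (@graftK m k)).
rewrite (eq_bigl (mem (family (fun _ : 'I_m => @proper_tree m k)))) => [|f];
  last by rewrite inE.
apply: eq_bigr => f /familyP fpr.
have fi : is_node (f i) [::] by have /proper_tree_nodeP[] := fpr i.
exact: (big_leaves_graft _ h fi).
Qed.

(** * Integration of product functions over iterated product spaces *)

Lemma measurable_fun_tensor d1 d2 (T1 : measurableType d1)
    (T2 : measurableType d2) (R : realType) (f : T1 -> R) (g : T2 -> R) :
  measurable_fun setT f -> measurable_fun setT g ->
  measurable_fun setT (fun z : T1 * T2 => f z.1 * g z.2).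
Proof.
move=> mf mg; apply: measurable_funM.
  exact: (measurableT_comp mf measurable_fst).
exact: (measurableT_comp mg measurable_snd).
Qed.

Section product_integral.
Variables (R : realType) (I : Type) (E : I -> par_space R).
Variable F : {s : I & par_type (E s)} -> R.
Hypothesis F_ge0 : forall a, 0 <= F a.
Hypothesis mF : forall s,
  measurable_fun setT (fun theta : par_type (E s) =>
    F (Tagged (fun s => par_type (E s)) theta)).

Lemma measurable_prod_coords (l : seq I) :
  measurable_fun setT (fun theta : par_type (prod_space E l) =>
    \prod_(a <- coords theta) F a).
Proof.
elim: l => [|s l IHl].
  by under eq_fun do rewrite big_nil; exact: measurable_cst.
under eq_fun do rewrite /= big_cons.
exact: (measurable_fun_tensor (@mF s) IHl).
Qed.

(** Tonelli removes one coordinate at a time. Since the values [a s] are real, the inner integral is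
    a finite constant that can be pulled out. *)
Lemma integral_prod_coords (a : I -> R) (l : seq I) :
  (forall s, \int[par_meas (E s)]_theta
     (F (Tagged (fun s => par_type (E s)) theta))%:E = (a s)%:E)%E ->
  (\int[par_meas (prod_space E l)]_theta (\prod_(c <- coords theta) F c)%:E
    = (\prod_(s <- l) a s)%:E)%E.
Proof.
move=> Fa; elim: l => [|s l IHl].
  by rewrite /= integral_dirac// diracT mul1e !big_nil.
pose f1 theta := F (Tagged (fun s => par_type (E s)) (theta : par_type (E s))).
pose f2 (theta : par_type (prod_space E l)) := \prod_(c <- coords theta) F c.
have f1_ge0 theta : 0 <= f1 theta by exact: F_ge0.
have f2_ge0 theta : 0 <= f2 theta by apply: prodr_ge0.
have mf2 : measurable_fun setT f2 := @measurable_prod_coords l.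
(* The measure of [pair_space] unfolds to the product measure, to which Tonelli applies. *)
transitivity (\int[par_meas (E s) \x par_meas (prod_space E l)]_z
    (f1 z.1 * f2 z.2)%:E)%E.
  by apply: eq_integral => z _; rewrite /= big_cons.
rewrite fubini_tonelli1 /=; last 2 first.
- by apply/measurable_EFinP; exact: measurable_fun_tensor (@mF s) mf2.
- by move=> z; rewrite lee_fin; exact: mulr_ge0.
transitivity (\int[par_meas (E s)]_y
    ((\prod_(s <- l) a s)%:E * (f1 y)%:E))%E.
  apply: eq_integral => y _; rewrite /fubini_F /=.
  under eq_integral do rewrite EFinM.
  rewrite ge0_integralZl//.
  - by rewrite IHl muleC.
  - exact/measurable_EFinP.
  - by move=> z _; rewrite lee_fin.
  - by rewrite lee_fin.
rewrite ge0_integralZl//.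
- by rewrite Fa -EFinM big_cons mulrC.
- by apply/measurable_EFinP; exact: mF.
- by move=> y _; rewrite lee_fin.
(* Each [a t] is nonnegative, being the integral of a nonnegative function. *)
- rewrite lee_fin; apply: prodr_ge0 => t _.
  by rewrite -lee_fin -Fa; apply: integral_ge0 => y _; rewrite lee_fin.
Qed.

End product_integral.

(** * Leaf counts and the factorisation of the tree prior *)

Lemma insub_bseqE (A : Type) (D : nat) (s : seq A) :
  (size s <= D)%N -> bseqval (insub_bseq D s) = s.
Proof. by move=> sD; rewrite val_insubd sD. Qed.

(** A node of maximal length has no child. *)
Lemma leaves_gt0 (m D : nat) (T : tree m D) : proper_tree T -> (0 < #|leaves T|)%N.
Proof.
move=> /proper_tree_nodeP[T0 _ _].
have rT : [bseq] \in T by have := is_node_bseq T [bseq]; rewrite T0.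
have [u uT umax] := @arg_maxnP _ [bseq] (mem T) (fun u => size u) rT.
apply/card_gt0P; exists u; rewrite in_leaves is_node_bseq (uT : u \in T).
apply/forallP => j; apply/negP => /is_nodeP[v vT vu].
by have := umax v vT; rewrite /= vu size_rcons ltnn.
Qed.

(** This writes the exponent of beta in the prior as a sum over leaves, so that the power splits
    into one factor per leaf. *)
Lemma card_shallow_leaves (m D : nat) (T : tree m D) :
  (\sum_(u in leaves T) (size u < D) = #|leaves T| - #|deep_leaves T|)%N.
Proof.
rewrite -big_mkcondr /= sum1_card -(cardsID (deep_leaves T) (leaves T)).
have /finset.setIidPr -> : deep_leaves T \subset leaves T.
  by apply/fintype.subsetP => u; rewrite inE => /andP[].
rewrite addKn; apply: eq_card => u.
rewrite [LHS]unfold_in finset.in_setD [u \in deep_leaves T]finset.in_set.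
by rewrite ltn_neqAle size_bseq; case: (_ \in leaves T); rewrite ?andbT ?andbF.
Qed.

(* The constant alpha of the tree prior. *)
Definition prior_scale (R : realType) (m : nat) (beta : R) : R :=
  (1 - beta) `^ (m.-1%:R^-1).

Lemma prior_scale_exp (R : realType) (m : nat) (beta : R) :
  (2 <= m)%N -> beta < 1 ->
  prior_scale m beta ^+ m = prior_scale m beta * (1 - beta).
Proof.
case: m => [|[|m]]// _ b1; rewrite exprS; congr (_ * _).
rewrite -powR_mulrn ?powR_ge0// -powRrM mulVf ?pnatr_eq0// powRr1//.
by rewrite subr_ge0 ltW.
Qed.

(** The extra alpha raises the exponent [#|leaves T| - 1] to one alpha per leaf; the truncated
    subtraction is harmless because a proper tree has a leaf. *)
Lemma tree_prior_prod (R : realType) (m D : nat) (beta : R) (T : tree m D)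
    (g : D.-bseq 'I_m -> R) :
  proper_tree T ->
  prior_scale m beta * (tree_prior beta T * \prod_(u in leaves T) g u) =
  \prod_(u in leaves T) (prior_scale m beta * beta ^+ (size u < D) * g u).
Proof.
move=> Tpr; rewrite !big_split /= prodr_const -expr_sum card_shallow_leaves.
by rewrite /tree_prior !mulrA -exprS subn1 prednK// leaves_gt0.
Qed.

(** * The evidence and the weighted probabilities as leaf sums *)

Section evidence.
Variables (R : realType) (m D n : nat) (Q : R -> 'I_m).
Variable x : (D + n).-tuple R.
Variable nu : {measure set (measurableTypeR R) -> \bar R}.
Variable M : D.-bseq 'I_m -> param_model nu.

Let leaf_weight (a : {s : D.-bseq 'I_m & par_type (Defs.space (M s))}) : R :=
  leaf_lik Q x (tagged a) * pdens (tagged a).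

Lemma leaf_weight_ge0 a : 0 <= leaf_weight a.
Proof.
apply: mulr_ge0; last exact: pdens_ge0.
by apply: prodr_ge0 => i _; exact: dens_ge0.
Qed.

Lemma measurable_leaf_lik s : measurable_fun setT
  (fun theta : par_type (Defs.space (M s)) => leaf_lik Q x theta).
Proof.
rewrite /leaf_lik; under eq_fun do rewrite -big_filter.
apply: (measurable_prod (h := fun i (theta : par_type (Defs.space (M s))) =>
  dens theta (past x i) (obs x i))) => i _.
exact: dens_measurable_par.
Qed.

Lemma measurable_leaf_weight s : measurable_fun setT
  (fun theta : par_type (Defs.space (M s)) =>
     leaf_weight (Tagged (fun s => par_type (Defs.space (M s))) theta)).
Proof.
by apply: measurable_funM; [exact: measurable_leaf_lik|exact: pdens_measurable].
Qed.

Lemma Pe_ext_ge0 s : (0 <= Pe_ext Q x M s)%E.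
Proof.
apply: integral_ge0 => theta _; rewrite lee_fin.
exact: (leaf_weight_ge0 (Tagged (fun s => par_type (Defs.space (M s))) theta)).
Qed.

Lemma PeK s : (Pe_ext Q x M s < +oo)%E -> (Pe Q x M s)%:E = Pe_ext Q x M s.
Proof. by move=> fin; rewrite fineK// ge0_fin_numE// Pe_ext_ge0. Qed.

(** The empty likelihood leaves only the prior density, whose integral is 1. *)
Lemma Pe_unvisited s : times_at Q x s = finset.set0 -> Pe Q x M s = 1.
Proof.
move=> s0; rewrite /Pe /Pe_ext.
under eq_integral do rewrite /leaf_lik s0 big_set0 mul1r.
by rewrite pdens_int1.
Qed.

Lemma evidence_Pe beta :
  (forall s, Pe_ext Q x M s < +oo)%E ->
  evidence Q x M beta = (\sum_(T : tree m D | proper_tree T)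
    tree_prior beta T * \prod_(s in leaves T) Pe Q x M s)%:E.
Proof.
move=> fin; rewrite /evidence -sumEFin; apply: eq_bigr => T _.
rewrite [RHS]EFinM -[in RHS]big_enum /=.
rewrite -(integral_prod_coords leaf_weight_ge0 measurable_leaf_weight); last first.
  by move=> s; rewrite PeK.
congr (_%:E * _)%E; apply: eq_integral => theta _; congr EFin.
by rewrite /likelihood /par_prior -big_split.
Qed.

(** The factor of a leaf [s] in alpha times the term of a tree. It takes plain strings to fit
    [leaf_sum]; the default of [insub_bseq] concerns only strings longer than [D]. *)
Let node_weight (beta : R) (s : seq 'I_m) : R :=
  prior_scale m beta * beta ^+ (size s < D) * Pe Q x M (insub_bseq D s).

Lemma leaf_sum_rcons k (h : seq 'I_m -> R) s j :
  leaf_sum k (fun r => h (s ++ j :: r)) = leaf_sum k (fun r => h (rcons s j ++ r)).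
Proof. by congr leaf_sum; apply/funext => r; rewrite cat_rcons. Qed.

(* Below an unvisited node all the estimated probabilities equal 1, and the
   prior on the subtrees at that node sums to 1. *)
Lemma leaf_sum_unvisited beta k s :
  (2 <= m)%N -> beta < 1 -> (size s + k = D)%N ->
  (forall i, ~~ prefix s (context Q x i)) ->
  leaf_sum k (fun r => node_weight beta (s ++ r)) = prior_scale m beta.
Proof.
move=> m2 b1; elim: k s => [|k IHk] s sk s0 /=.
all: rewrite cats0 [node_weight _ s]/node_weight.
all: rewrite Pe_unvisited ?mulr1.
2,4: apply/setP => i; rewrite !inE insub_bseqE -?sk ?leq_addr//.
2,3: exact/negbTE.
  by rewrite -[X in (_ < X)%N]sk addn0 ltnn mulr1.
have -> : (size s < D)%N by rewrite -sk addnS ltnS leq_addr.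
rewrite expr1.
(* By induction each child contributes alpha, and alpha beta + alpha^m = alpha beta + alpha (1 -
   beta) = alpha. *)
rewrite (eq_bigr (fun=> prior_scale m beta)) => [|j _].
  rewrite prodr_const card_ord prior_scale_exp// -mulrDr.
  by rewrite addrC subrK mulr1.
rewrite (leaf_sum_rcons k (node_weight beta)) IHk ?size_rcons ?addSnnS// => i.
by apply: contra (s0 i); apply: prefix_trans; exact: prefix_rcons.
Qed.

(** A context has length [D], so it would extend [s] strictly; as it is a node of [T], its prefix
    one symbol longer than [s] would be a child of the leaf [s]. *)
Lemma leaf_unvisited (T : tree m D) (s : D.-bseq 'I_m) i :
  proper_tree T -> has_contexts Q x T -> s \in leaves T -> (size s < D)%N ->
  ~~ prefix s (context Q x i).
Proof.
move=> Tpr Tc sl sD; apply/negP => /prefixP[[|j r] cE].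
  have := size_tuple (context Q x i); rewrite cE cats0 => sE.
  by rewrite sE ltnn in sD.
have := Tc i; rewrite in_leaves => /andP[+ _]; rewrite /= cE -cat_rcons.
move=> /(is_node_prefix Tpr) sj.
by move: sl; rewrite in_leaves => /andP[_ /forallP/(_ j)]; rewrite sj.
Qed.

Lemma weighted_leaf_sum beta (T : tree m D) (Pw : seq 'I_m -> R) k s :
  (2 <= m)%N -> beta < 1 -> proper_tree T -> has_contexts Q x T ->
  is_weighted Q x M beta T Pw -> (size s + k = D)%N -> is_node T s ->
  prior_scale m beta * Pw s = leaf_sum k (fun r => node_weight beta (s ++ r)).
Proof.
move=> m2 b1 Tpr Tc [Pw_leaf Pw_node].
elim: k s => [|k IHk] s sk /is_nodeP[u uT us].
  (* Here [s] has length [D]: it is necessarily a leaf, and the exponent of beta is 0. *)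
  rewrite /= cats0 [node_weight _ s]/node_weight -[X in (_ < X)%N]sk addn0 ltnn.
  rewrite mulr1 -us Pw_leaf.
    by rewrite /insub_bseq /insubd valK.
  rewrite in_leaves is_node_bseq uT; apply/forallP => j.
  by apply/negP => /is_node_size; rewrite size_rcons us -sk addn0 ltnn.
have sD : (size s < D)%N by rewrite -sk addnS ltnS leq_addr.
have uE : insub_bseq D s = u by apply: val_inj; rewrite /= insub_bseqE// ltnW.
(* At a leaf above depth [D], [Pw] stops while [leaf_sum] continues; no context passes through it,
   so both sides equal alpha. *)
have [ul|ul] := boolP (u \in leaves T).
  have s0 i : ~~ prefix s (context Q x i).
    by rewrite -us; apply: leaf_unvisited Tpr Tc ul _; rewrite us.
  rewrite (leaf_sum_unvisited _ _ sk)// -us Pw_leaf// Pe_unvisited ?mulr1//.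
  by apply/setP => i; rewrite !inE us; apply/negbTE.
rewrite -us Pw_node// us /= cats0 [node_weight _ s]/node_weight sD expr1 uE.
(* The factor alpha (1 - beta) = alpha^m hands one alpha to each of the [m] children, as the
   induction hypothesis requires. *)
rewrite mulrDr !mulrA -prior_scale_exp// -[X in _ ^+ X]card_ord -prodr_const -big_split /=.
congr (_ + _); apply: eq_bigr => j _.
rewrite (leaf_sum_rcons k (node_weight beta)) IHk ?size_rcons ?addSnnS//.
have /proper_treeP[_ _ Tch] := Tpr; rewrite -us; exact: Tch.
Qed.

Lemma root_evidence beta (T : tree m D) (Pw : seq 'I_m -> R) :
  (2 <= m)%N -> beta < 1 -> (forall s, Pe_ext Q x M s < +oo)%E ->
  proper_tree T -> has_contexts Q x T -> is_weighted Q x M beta T Pw ->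
  (Pw [::])%:E = evidence Q x M beta.
Proof.
move=> m2 b1 fin Tpr Tc TPw; rewrite evidence_Pe//; congr EFin.
(* Both sides are compared after multiplication by alpha, which is positive since beta < 1. *)
have a0 : prior_scale m beta != 0 by rewrite gt_eqF// powR_gt0// subr_gt0.
apply: (mulfI a0).
rewrite (weighted_leaf_sum m2 b1 Tpr Tc TPw (s := [::]) (k := D))//=; last first.
  by have /proper_tree_nodeP[] := Tpr.
rewrite -(sum_proper_tree D (node_weight beta)); last exact: ltnW m2.
rewrite mulr_sumr; apply: eq_bigr => T' T'pr.
rewrite tree_prior_prod//; apply: eq_bigr => u _.
by rewrite /node_weight /insub_bseq /insubd valK.
Qed.

End evidence.

Theorem theorem1 (R : realType) (m D n : nat) (beta : R)
    (x : (D + n).-tuple R) (c : nat -> R) (Q : R -> 'I_m)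
    (nu : {measure set (measurableTypeR R) -> \bar R})
    (M : D.-bseq 'I_m -> param_model nu)
    (Tmax : tree m D) (Pw : seq 'I_m -> R) :
  (2 <= m)%N -> (1 <= n)%N -> 0 < beta -> beta < 1 ->
  is_quantiser c Q ->
  (forall s : D.-bseq 'I_m, (Pe_ext Q x M s < +oo)%E) ->
  is_Tmax Q x Tmax ->
  is_weighted Q x M beta Tmax Pw ->
  (Pw [::])%:E = evidence Q x M beta.
Proof.
by move=> m2 _ _ b1 _ fin [Tpr Tc _]; exact: root_evidence.
Qed.
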